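(* Let $n$ be a positive integer. The set of vertices of the alternating sign matrix polytope $\mathcal{A}_n\subset\mathbb{R}^{n\times n}$ is exactly the set of standard alternating sign matrices of size $n$.
   Context: For a positive integer $n$, the alternating sign matrix polytope $\mathcal{A}_n$ is the set of real $n\times n$ matrices $x=(x_{ij})$ such that all of the following hold: - $\sum_{j'=1}^n x_{ij'}=\sum_{i'=1}^n x_{i'j}=1$ for all $1\le i,j\le n$; - $\sum_{j'=1}^{j}x_{ij'}\ge 0$ for all $1\le i\le n$, $1\le j\le n-1$; - $\sum_{j'=j}^{n}x_{ij'}\ge 0$ for all $1\le i\le n$, $2\le j\le n$; - $\sum_{i'=1}^{i}x_{i'j}\ge 0$ for all $1\le i\le n-1$, $1\le j\le n$; - $\sum_{i'=i}^{n}x_{i'j}\ge 0$ for all $2\le i\le n$, $1\le j\le n$. This is a bounded intersection of finitely many closed halfspaces and hyperplanes in $\mathbb{R}^{n^2}$, i.e. a convex polytope. A vertex of a convex polytope $\mathcal{P}\subset\mathbb{R}^m$ is a point $p\in\mathcal{P}$ for which there is a closed affine halfspace $\mathcal{S}$ with $\mathcal{P}\cap\mathcal{S}=\{p\}$; equivalently, a point $p\in\mathcal{P}$ for which there do not exist $\lambda\in(0,1)$ and $p_1\neq p_2$ in $\mathcal{P}$ with $p=\lambda p_1+(1-\lambda)p_2$. A standard alternating sign matrix of size $n$ is an $n\times n$ matrix in which each entry is $0$, $1$ or $-1$, each row and column contains at least one nonzero entry, and along each row and each column the nonzero entries alternate in sign, starting and finishing with a $1$. Equivalently, it is an integer matrix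 lying in $\mathcal{A}_n$. *)

(* Defs.v *)
From HB Require Import structures.
From mathcomp Require Import all_boot all_order all_algebra.
From mathcomp Require Import classical_sets reals.
Set Implicit Arguments.
Unset Strict Implicit.
Unset Printing Implicit Defensive.
Import Order.TTheory GRing.Theory Num.Theory.
Local Open Scope ring_scope.
Local Open Scope classical_set_scope.

(* 'M[R]_(m, n) plays the role of R^(m n), with the entrywise scalar product. *)
Definition halfspace (R : realType) (m n : nat) (a : 'M[R]_(m, n)) (b : R) :
    set 'M[R]_(m, n) :=
  [set x | \sum_i \sum_j a i j * x i j <= b].

Definition is_closed_halfspace (R : realType) (m n : nat)
    (S : set 'M[R]_(m, n)) : Prop :=
  exists (a : 'M[R]_(m, n)) (b : R), a != 0 /\ S = halfspace a b.

Definition vertices (R : realType) (m n : nat) (P : set 'M[R]_(m, n)) :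
    set 'M[R]_(m, n) :=
  [set p | P p /\
           exists S : set 'M[R]_(m, n), is_closed_halfspace S /\ P `&` S = [set p]].

(* Indices start at 0: with j0 = j - 1, the range 1 <= j <= n - 1 reads
   j0.+1 < n, and 2 <= j <= n reads 0 < j0. *)
Definition asm_polytope (R : realType) (n : nat) : set 'M[R]_n :=
  [set x |
    [/\ forall i j : 'I_n, \sum_j' x i j' = 1 /\ \sum_i' x i' j = 1,
        forall i j : 'I_n, (j.+1 < n)%N -> 0 <= \sum_(j' < n | (j' <= j)%N) x i j',
        forall i j : 'I_n, (0 < j)%N -> 0 <= \sum_(j' < n | (j <= j')%N) x i j',
        forall i j : 'I_n, (i.+1 < n)%N -> 0 <= \sum_(i' < n | (i' <= i)%N) x i' j
      & forall i j : 'I_n, (0 < i)%N -> 0 <= \sum_(i' < n | (i <= i')%N) x i' j]].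

Definition nonzero_entries (R : realType) (n : nat) (v : 'I_n -> R) : seq R :=
  [seq a <- [seq v i | i <- enum 'I_n] | a != 0].

Definition alternating_line (R : realType) (n : nat) (v : 'I_n -> R) : Prop :=
  let s := nonzero_entries v in
  [/\ s != [::], sorted (fun a b : R => a * b < 0) s,
      head 0 s = 1 & last 0 s = 1].

Definition standard_asm (R : realType) (n : nat) : set 'M[R]_n :=
  [set x |
    [/\ forall i j : 'I_n, [\/ x i j = 0, x i j = 1 | x i j = -1],
        forall i : 'I_n, alternating_line (fun j => x i j)
      & forall j : 'I_n, alternating_line (fun i => x i j)]].

Arguments asm_polytope : clear implicits.
Arguments standard_asm : clear implicits.

(* Main.v *)
(* In terms of the corner sums c(i, j) of the entries in the first i rows and j
   columns, the polytope is cut out by 0 <= c(i+1, j) - c(i, j) <= 1 and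
   0 <= c(i, j+1) - c(i, j) <= 1, with boundary values c(i, n) = i and
   c(n, j) = j.  Any nondecreasing F : R -> R with F(a + 1) = F(a) + 1 respects
   these constraints.  Applying F(a) = a + u(1 - u) and F(a) = a - u(1 - u),
   with u the fractional part of a, writes a point as the midpoint of two points
   of the polytope, which are distinct unless all corner sums are integers;
   hence a vertex has all its partial sums in {0, 1}.  Conversely such a matrix
   is singled out by its row partial sums, each of which is extremal in
   [0, 1]. *)
Require Import Defs.
From mathcomp Require Import all_boot all_order all_algebra.
From mathcomp Require Import classical_sets reals.
From mathcomp Require Import boolp ring lra.
Import Order.TTheory GRing.Theory Num.Theory.
Set Implicit Arguments.
Unset Strict Implicit.
Unset Printing Implicit Defensive.
Local Open Scope ring_scope.

(** * Alternating lines *)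

Definition psum (R : nmodType) (n : nat) (v : 'I_n -> R) (k : nat) : R :=
  \sum_(j < n | (j < k)%N) v j.

Lemma take_enum_ord (n k : nat) :
  take k (enum 'I_n) = [seq i : 'I_n <- enum 'I_n | (i < k)%N].
Proof.
apply: (inj_map val_inj); rewrite map_take val_enum_ord.
rewrite -(filter_map val (fun i => i < k)%N) val_enum_ord.
have [lekn|ltnk] := leqP k n; last first.
  rewrite take_oversize ?size_iota 1?ltnW //; apply/esym/all_filterP/allP => i.
  by rewrite mem_iota => /andP[_]; rewrite add0n => /ltn_trans; apply.
rewrite -(subnKC lekn) iotaD take_size_cat ?size_iota // filter_cat add0n.
rewrite (all_filterP _) ?(eq_in_filter (a2 := pred0)) ?filter_pred0 ?cats0 //.
  by move=> i; rewrite mem_iota => /andP[/leq_gtF].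
by apply/allP => i; rewrite mem_iota.
Qed.

Lemma psum_take (R : nmodType) (n : nat) (v : 'I_n -> R) (k : nat) :
  psum v k = \sum_(a <- take k [seq v i | i <- enum 'I_n]) a.
Proof. by rewrite -map_take take_enum_ord big_map big_filter big_enum_cond. Qed.

Lemma psum_oversize (R : nmodType) (n : nat) (v : 'I_n -> R) (k : nat) :
  (n <= k)%N -> psum v k = \sum_j v j.
Proof.
by move=> lenk; apply: eq_bigl => j; rewrite (leq_trans (ltn_ord j) lenk).
Qed.

Lemma psumS (R : nmodType) (n : nat) (v : 'I_n -> R) (i : 'I_n) :
  psum v i.+1 = psum v i + v i.
Proof.
rewrite /psum (bigD1 i) //= addrC; congr (_ + _); apply: eq_bigl => j.
by rewrite ltnS ltn_neqAle andbC.
Qed.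

Lemma psum0 (R : nmodType) (n : nat) (v : 'I_n -> R) : psum v 0 = 0.
Proof. by rewrite /psum big_pred0. Qed.

(* The boolean [b] records the current partial sum, so that [2 b - 1] is the
   last nonzero entry already read; the start [b = false] acts as a virtual
   entry [-1]. *)
Lemma alternating_path (R : realDomainType) (s : seq R) (b : bool) :
  (forall k, b%:R + \sum_(a <- take k s) a \in [:: 0; 1]) <->
  (forall a, a \in s -> a \in [:: 0; 1; -1]) /\
  path (fun a c : R => a * c < 0) (2 * b%:R - 1) [seq a <- s | a != 0].
Proof.
elim: s b => [|a s IH] b /=.
  split=> // _ k; rewrite big_nil addr0 !inE.
  by case: b; rewrite eqxx ?orbT.
split=> [H|[Hs Hp]].
  have := H 1%N; rewrite /= take0 big_seq1 => H1.
  have {H}Hb (b' : bool) : b%:R + a = b'%:R ->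
      forall k, b'%:R + \sum_(a <- take k s) a \in [:: 0; 1].
    by move=> <- k; have := H k.+1; rewrite /= big_cons addrA.
  have [b' Eb'] : exists b' : bool, b%:R + a = b'%:R.
    move: H1; rewrite !inE => /orP[] /eqP ->; [by exists false|by exists true].
  have [Hs Hp] := (IH b').1 (Hb b' Eb').
  have Ea : a = b'%:R - b%:R by rewrite -Eb' addrC addKr.
  split.
    move=> c; rewrite inE => /orP[/eqP ->|/Hs //].
    rewrite Ea !inE.
    by case: (b) (b') => -[]; rewrite ?subrr ?subr0 ?sub0r eqxx ?orbT.
  case: ifP => [a0|/negbFE/eqP a0] /=.
    have -> : a = 2 * b'%:R - 1.
      by move: a0; rewrite Ea; case: (b) (b') => -[]; rewrite ?subrr ?eqxx //=;
        move=> _; ring.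
    rewrite Hp andbT.
    by move: a0; rewrite Ea; case: (b) (b') => -[]; rewrite ?subrr ?eqxx //=;
      move=> _; lra.
  by move: Hp; rewrite -Eb' a0 addr0.
have {}IH (b' : bool) : b%:R + a = b'%:R ->
    path (fun a c : R => a * c < 0) (2 * b'%:R - 1) [seq a <- s | a != 0] ->
    forall k, b%:R + \sum_(a <- take k (a :: s)) a \in [:: 0; 1].
  move=> Eb' Hp' [|k].
    by rewrite big_nil addr0 !inE; case: (b); rewrite eqxx ?orbT.
  rewrite /= big_cons addrA Eb'; apply: (IH b').2; split=> // c sc.
  by apply: Hs; rewrite inE sc orbT.
move: Hp; have := Hs a (mem_head _ _); rewrite !inE => /or3P[] /eqP Ea; subst a.
- by rewrite eqxx /= => Hp; apply: (IH b) => //; rewrite addr0.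
- rewrite oner_eq0 /= => /andP[]; case: b IH => IH /=.
    by move=> ?; exfalso; lra.
  move=> _ Hp; apply: (IH true); first by rewrite add0r.
  by have -> : 2 * true%:R - 1 = 1 :> R by rewrite /=; ring.
- rewrite oppr_eq0 oner_eq0 /= => /andP[]; case: b IH => IH /=.
    move=> _ Hp; apply: (IH false); first by rewrite subrr.
    by have -> : 2 * false%:R - 1 = -1 :> R by rewrite /=; ring.
  by move=> ?; exfalso; lra.
Qed.

(** A nonzero entry either raises the running sum to 1 or lowers it to 0, so the final sum tells
    which came last; with no nonzero entry the virtual start remains. *)
Lemma alternating_last (R : realDomainType) (s : seq R) (b : bool) :
  (forall k, b%:R + \sum_(a <- take k s) a \in [:: 0; 1]) ->
  last (2 * b%:R - 1) [seq a <- s | a != 0] = 2 * (b%:R + \sum_(a <- s) a) - 1.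
Proof.
elim: s b => [|a s IH] b H /=; first by rewrite big_nil addr0.
have := H 1%N; rewrite /= take0 big_seq1 => H1.
have [b' Eb'] : exists b' : bool, b%:R + a = b'%:R.
  move: H1; rewrite !inE => /orP[] /eqP ->; [by exists false|by exists true].
rewrite big_cons addrA Eb' -IH; last first.
  by move=> k; have := H k.+1; rewrite /= big_cons addrA Eb'.
case: ifP => [a0|/negbFE/eqP a0] /=; last by rewrite -Eb' a0 addr0.
congr last; have Ea : a = b'%:R - b%:R by rewrite -Eb' addrC addKr.
by move: a0; rewrite Ea; case: (b) (b') => -[]; rewrite ?subrr ?eqxx //=;
  move=> _; ring.
Qed.

(** Starting from [b = false] puts a virtual -1 before the line, which forces the first nonzero
    entry to be 1; a total of 1 forces the last one to be 1. *)
Lemma alternating_lineP (R : realType) (n : nat) (v : 'I_n -> R) :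
  (forall i, [\/ v i = 0, v i = 1 | v i = -1]) /\ alternating_line v <->
  (forall k, psum v k \in [:: 0; 1]) /\ \sum_j v j = 1.
Proof.
pose s := [seq v i | i <- enum 'I_n].
have psE k : psum v k = false%:R + \sum_(a <- take k s) a.
  by rewrite add0r psum_take.
have totE : \sum_j v j = \sum_(a <- s) a by rewrite big_map big_enum.
have := alternating_path s false; have := @alternating_last R s false.
rewrite mulr0 sub0r add0r -totE => lastE pathE.
rewrite /alternating_line /nonzero_entries -/s.
split=> [[Hv [s0 srt hd lst]]|[Hps tot]].
  have Hps : forall k, psum v k \in [:: 0; 1].
    move=> k; rewrite psE; apply: pathE.2; split.
      move=> _ /mapP[i _ ->]; rewrite !inE.
      by case: (Hv i) => ->; rewrite eqxx ?orbT.
    move: s0 srt hd; case: filter => //= a l _ -> ->.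
    by rewrite mulr1 oppr_lt0 ltr01.
  split=> //; have : last (-1) [seq a <- s | a != 0] = 1.
    by rewrite -lst; case: filter s0.
  by rewrite lastE => [|k]; [lra|rewrite -psE].
have Hps' k : false%:R + \sum_(a <- take k s) a \in [:: 0; 1].
  by rewrite -psE.
have [Hv Hp] := pathE.1 Hps'; have {}lastE := lastE Hps'.
rewrite tot in lastE; split.
  move=> i; have : v i \in s by rewrite map_f ?mem_enum.
  move/Hv; rewrite !inE => /or3P[] /eqP ->.
  - exact: Or31.
  - exact: Or32.
  - exact: Or33.
have Hin a : a \in [seq a <- s | a != 0] -> a \in [:: 0; 1; -1].
  by rewrite mem_filter => /andP[_ /Hv].
(* With no nonzero entry the last one would be the virtual -1, against the value 1 given by the
   total. *)
move: lastE Hp Hin; case: filter => [|a l] /= Hl Hp Hin.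
  by exfalso; lra.
case/andP: Hp => a0 Hp; split=> //; last by rewrite Hl; lra.
by have := Hin a (mem_head _ _); rewrite !inE => /or3P[] /eqP Ea;
  rewrite // Ea in a0 *; exfalso; lra.
Qed.

(** * Partial sums of polytope points *)

(** Prefix and suffix sums are complementary in the total 1, so nonnegative suffixes are encoded as
    upper bounds on prefixes. Letting [k] be any natural adds only trivial prefixes. *)
Definition line_polytope (R : realType) (n : nat) (v : 'I_n -> R) : Prop :=
  (forall k, 0 <= psum v k <= 1) /\ \sum_j v j = 1.

Lemma psum_compl (R : zmodType) (n : nat) (v : 'I_n -> R) (k : nat) :
  \sum_(j < n | (k <= j)%N) v j = \sum_j v j - psum v k.
Proof.
rewrite /psum [X in _ = X - _](bigID (fun j : 'I_n => (j < k)%N)) /=.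
rewrite addrC addrK.
by apply: eq_bigl => j; rewrite -leqNgt.
Qed.

Lemma line_polytopeP (R : realType) (n : nat) (v : 'I_n -> R) :
  line_polytope v <->
  [/\ \sum_j v j = 1,
      forall j : 'I_n, (j.+1 < n)%N -> 0 <= \sum_(j' < n | (j' <= j)%N) v j'
    & forall j : 'I_n, (0 < j)%N -> 0 <= \sum_(j' < n | (j <= j')%N) v j'].
Proof.
split=> [[Hv tot]|[tot Hl Hr]]; split=> //.
- by move=> j _; case/andP: (Hv j.+1).
- by move=> j _; rewrite psum_compl tot subr_ge0; case/andP: (Hv j).
case=> [|k]; first by rewrite psum0 lexx ler01.
have [lenk|ltkn] := leqP n k.+1.
  by rewrite psum_oversize // tot ler01 lexx.
(* The prefix of length [k.+1] ends at index [k]; its complementary suffix starts at index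
   [k.+1]. *)
rewrite (Hl (Ordinal (ltnW ltkn))) //=.
by have := Hr (Ordinal ltkn) isT; rewrite psum_compl tot subr_ge0.
Qed.

Lemma asm_polytopeP (R : realType) (n : nat) (x : 'M[R]_n) :
  asm_polytope R n x <->
  (forall i, line_polytope (x i)) /\ (forall j, line_polytope (x^T j)).
Proof.
have colE (P : pred 'I_n) j : \sum_(i | P i) x^T j i = \sum_(i | P i) x i j.
  by apply: eq_bigr => i _; rewrite mxE.
split=> [[H1 H2 H3 H4 H5]|[Hr Hc]].
  split=> i; apply/line_polytopeP; split.
  - by case: (H1 i i).
  - by move=> j; apply: H2.
  - by move=> j; apply: H3.
  - by rewrite colE; case: (H1 i i).
  - by move=> j; rewrite colE; apply: H4.
  - by move=> j; rewrite colE; apply: H5.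
have {}Hr i := (line_polytopeP _).1 (Hr i).
have {}Hc i := (line_polytopeP _).1 (Hc i).
split.
- by move=> i j; rewrite -colE; case: (Hr i) => -> _ _; case: (Hc j) => -> _ _.
- by move=> i j; case: (Hr i) => _ H _; apply: H.
- by move=> i j; case: (Hr i) => _ _ H; apply: H.
- by move=> i j; rewrite -colE; case: (Hc j) => _ H _; apply: H.
- by move=> i j; rewrite -colE; case: (Hc j) => _ _ H; apply: H.
Qed.

Lemma standard_asmP (R : realType) (n : nat) (x : 'M[R]_n) :
  standard_asm R n x <->
  asm_polytope R n x /\
  ((forall i k, psum (x i) k \in [:: 0; 1]) /\
   (forall j k, psum (x^T j) k \in [:: 0; 1])).
Proof.
have trE j : x^T j = fun i => x i j by apply: funext => i; rewrite mxE.
rewrite asm_polytopeP; split=> [[H0 Hr Hc]|[[Pr Pc] [Hr Hc]]].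
  have {}Hr i := (alternating_lineP (x i)).1 (conj (H0 i) (Hr i)).
  have {}Hc j := (alternating_lineP (fun i => x i j)).1 (conj (H0^~ j) (Hc j)).
  have itv (a : R) : a \in [:: 0; 1] -> 0 <= a <= 1.
    by rewrite !inE => /orP[] /eqP ->; rewrite lexx ler01.
  split; split=> i.
  - by case: (Hr i) => H tot; split=> // k; apply: itv.
  - by rewrite trE; case: (Hc i) => H tot; split=> // k; apply: itv.
  - by case: (Hr i).
  - by rewrite trE; case: (Hc i).
have {}Hr i := (alternating_lineP (x i)).2 (conj (Hr i) (Pr i).2).
have {}Hc j : alternating_line (fun i => x i j).
  by have := (alternating_lineP _).2 (conj (Hc j) (Pc j).2); rewrite trE => -[].
by split=> // i; case: (Hr i).
Qed.

(** * Corner sums *)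

Definition corner (R : nmodType) (n : nat) (x : 'M[R]_n) (i j : nat) : R :=
  psum (fun i' => psum (x i') j) i.

Lemma corner_tr (R : nmodType) (n : nat) (x : 'M[R]_n) (i j : nat) :
  corner x^T i j = corner x j i.
Proof.
rewrite /corner /psum exchange_big; apply: eq_bigr => k _.
by apply: eq_bigr => l _; rewrite mxE.
Qed.

Lemma cornerS (R : nmodType) (n : nat) (x : 'M[R]_n) (i : 'I_n) (j : nat) :
  corner x i.+1 j = corner x i j + psum (x i) j.
Proof. by rewrite /corner psumS. Qed.

Lemma corner0l (R : nmodType) (n : nat) (x : 'M[R]_n) (j : nat) :
  corner x 0 j = 0.
Proof. exact: psum0. Qed.

Lemma corner0r (R : nmodType) (n : nat) (x : 'M[R]_n) (i : nat) :
  corner x i 0 = 0.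
Proof. by rewrite -corner_tr corner0l. Qed.

(* Mixed second differences recover a matrix from its corner sums. *)
Definition deform (R : zmodType) (n : nat) (F : R -> R) (x : 'M[R]_n) :
    'M[R]_n :=
  \matrix_(i, j) ((F (corner x i.+1 j.+1) - F (corner x i j.+1))
                - (F (corner x i.+1 j) - F (corner x i j))).

(** Mixed differences are symmetric in the two directions; this carries row facts over to
    columns. *)
Lemma deform_tr (R : zmodType) (n : nat) (F : R -> R) (x : 'M[R]_n) :
  (deform F x)^T = deform F x^T.
Proof.
by apply/matrixP => i j; rewrite !mxE !corner_tr !opprB addrACA [RHS]addrACA
  [- _ + _]addrC.
Qed.

(** The mixed differences telescope along the row. At column 0 both corner sums vanish, so the two
    values [F 0] cancel. *)
Lemma psum_deform (R : zmodType) (n : nat) (F : R -> R) (x : 'M[R]_n)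
    (i : 'I_n) (k : nat) :
  (k <= n)%N ->
  psum (deform F x i) k = F (corner x i.+1 k) - F (corner x i k).
Proof.
elim: k => [|k IH] lekn; first by rewrite psum0 !corner0r subrr.
rewrite (psumS _ (Ordinal lekn)) /= IH 1?ltnW // mxE /=.
by rewrite addrC subrK.
Qed.

(** Vertically adjacent corner sums [c <= c'] satisfy [c' <= c + 1], hence [F c <= F c' <= F c + 1]:
    the new prefix sums stay in [0, 1]. *)
Lemma deform_row (R : realType) (n : nat) (F : R -> R) (x : 'M[R]_n) :
  {homo F : a b / a <= b} -> (forall a, F (a + 1) = F a + 1) ->
  (forall i, line_polytope (x i)) ->
  forall i, line_polytope (deform F x i).
Proof.
move=> Fle F1 Hx i; have [Hi tot] := Hx i.
have tot' : \sum_j deform F x i j = 1.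
  rewrite -(@psum_oversize _ _ _ n) // psum_deform // cornerS.
  by rewrite psum_oversize // tot F1 addrC addKr.
split=> // k; have [lekn|/ltnW lenk] := leqP k n; last first.
  by rewrite psum_oversize // tot' ler01 lexx.
rewrite psum_deform // cornerS; case/andP: (Hi k) => ge0 le1.
by rewrite subr_ge0 lerBlDl -F1 !Fle ?lerDl ?lerD2l.
Qed.

Lemma deform_asm (R : realType) (n : nat) (F : R -> R) (x : 'M[R]_n) :
  {homo F : a b / a <= b} -> (forall a, F (a + 1) = F a + 1) ->
  asm_polytope R n x -> asm_polytope R n (deform F x).
Proof.
move=> Fle F1 /asm_polytopeP[Hr Hc]; apply/asm_polytopeP.
by split; [|rewrite deform_tr]; apply: deform_row.
Qed.

(** * Vertices *)

(* For [|s| <= 1] this is nondecreasing, and for [s != 0] its fixed points are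
   exactly the integers. *)
Definition bend (R : realType) (s a : R) : R :=
  let u := a - (Num.floor a)%:~R in a + s * (u * (1 - u)).

Lemma bendD1 (R : realType) (s a : R) : bend s (a + 1) = bend s a + 1.
Proof.
rewrite /bend floorDrz ?rpred1 // floor1 intrD; ring.
Qed.

(** Within one unit interval the chord slopes are nonnegative; across intervals the integer
    [floor a + 1] separates the two values. *)
Lemma bend_homo (R : realType) (s : R) :
  -1 <= s <= 1 -> {homo bend s : a b / a <= b}.
Proof.
move=> /andP[sge sle] a b leab; rewrite /bend.
have := floor_itv a; have := floor_itv b.
have := Num.Theory.le_floor leab; rewrite intrD le_eqVlt => /orP[/eqP ->|].
  set f := _%:~R => /andP[fb bf] /andP[fa af].
  have -> : b + s * ((b - f) * (1 - (b - f))) =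
    a + s * ((a - f) * (1 - (a - f))) +
    (b - a) * (1 + s * (1 - (a - f) - (b - f))) by ring.
  rewrite lerDl mulr_ge0 ?subr_ge0 //.
  have : -1 <= 1 - (a - f) - (b - f) <= 1 by lra.
  move: (1 - _ - _) => t /andP[tge tle].
  (* This product and the next add up to [2 * (1 + s * t)], so the chord slope [1 + s * t] is
     nonnegative. *)
  have : 0 <= (1 + s) * (1 + t) by apply: mulr_ge0; lra.
  have : 0 <= (1 - s) * (1 - t) by apply: mulr_ge0; lra.
  lra.
rewrite -lezD1 -(ler_int R) !intrD.
set f := (Num.floor a)%:~R; set g := (Num.floor b)%:~R => fg.
move=> /andP[gb bg] /andP[fa af].
have : 0 <= (1 - s) * ((a - f) * (1 - (a - f))) by rewrite !mulr_ge0 //; lra.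
have : 0 <= (1 + s) * ((b - g) * (1 - (b - g))) by rewrite !mulr_ge0 //; lra.
have := sqr_ge0 (1 - (a - f)); have := sqr_ge0 (b - g).
(* These forms exhibit the value at [a] as at most [f + 1] and the value at [b] as at least [g]. *)
have -> : a + s * ((a - f) * (1 - (a - f))) =
  f + 1 - (1 - (a - f)) ^+ 2 - (1 - s) * ((a - f) * (1 - (a - f))) by ring.
have -> : b + s * ((b - g) * (1 - (b - g))) =
  g + (b - g) ^+ 2 + (1 + s) * ((b - g) * (1 - (b - g))) by ring.
lra.
Qed.

Lemma bend_fixed (R : realType) (a : R) : bend 1 a = a -> a \is a Num.int.
Proof.
rewrite /bend mul1r => /eqP; rewrite -subr_eq0 addrC addKr mulf_eq0.
have /andP[fa af] := floor_itv a.
case/orP; rewrite subr_eq0 => /eqP E.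
  by rewrite E intr_int.
by exfalso; move: af; rewrite intrD; lra.
Qed.

(** The functional of the exposing halfspace averages to its value at [p], so [q] or [r] lies in the
    halfspace and equals [p]; then so does the other. *)
Lemma vertices_midpoint (R : realType) (m n : nat) (P : set 'M[R]_(m, n))
    (p q r : 'M[R]_(m, n)) :
  vertices P p -> P q -> P r -> q + r = p + p -> q = p.
Proof.
move=> [Pp [_ [[a [b [_ ->]]] PS]]] Pq Pr qr.
pose L (x : 'M[R]_(m, n)) := \sum_i \sum_j a i j * x i j.
have LD x y : L (x + y) = L x + L y.
  rewrite -big_split; apply: eq_bigr => i _; rewrite -big_split.
  by apply: eq_bigr => j _; rewrite mxE mulrDr.
have Lle x : P x -> L x <= b -> x = p.
  by move=> Px Lx; have : [set p]%classic x by rewrite -PS.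
have Lp : L p <= b.
  by have : [set p]%classic p by []; rewrite -PS => -[].
have := LD q r; rewrite qr LD => E.
have [/Lle->//|Lq] := leP (L q) b.
have rp : r = p by apply: Lle => //; lra.
by move: qr; rewrite rp => /addIr.
Qed.

Lemma vertex_corner_int (R : realType) (n : nat) (p : 'M[R]_n) (i k : nat) :
  vertices (asm_polytope R n) p -> (i <= n)%N -> (k <= n)%N ->
  corner p i k \is a Num.int.
Proof.
move=> Vp lein lekn; apply: bend_fixed.
have [Pp _] := Vp.
(* The corrections for [s = 1] and [s = -1] are opposite, so [p] is the midpoint of the two
   deformations. *)
have defp : deform (bend 1) p = p.
  apply: (vertices_midpoint (r := deform (bend (-1)) p) Vp).
  - by apply: deform_asm => //; [apply: bend_homo; lra|apply: bendD1].
  - by apply: deform_asm => //; [apply: bend_homo; lra|apply: bendD1].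
  apply/matrixP => a b; rewrite !mxE /bend !cornerS psumS; ring.
(* [defp] only equates row increments; starting from corner sum 0, which [bend 1] fixes, they give
   fixedness row by row. *)
elim: i lein => [|i IH] lein.
  by rewrite corner0l /bend floor0 subrr mul0r mulr0 addr0.
have := psum_deform (bend 1) p (Ordinal lein) lekn.
rewrite defp (cornerS _ (Ordinal lein)) /= IH 1?ltnW // => E.
by rewrite [in RHS]E [RHS]addrC subrK.
Qed.

Lemma vertex_psum (R : realType) (n : nat) (p : 'M[R]_n) (i : 'I_n) (k : nat) :
  vertices (asm_polytope R n) p -> psum (p i) k \in [:: 0; 1].
Proof.
move=> Vp; have [/asm_polytopeP[Hr _] _] := Vp; have [Hi tot] := Hr i.
have [lekn|/ltnW lenk] := leqP k n; last first.
  by rewrite psum_oversize // tot !inE eqxx orbT.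
have : psum (p i) k \is a Num.int.
  rewrite -[psum _ _](addKr (corner p i k)) -cornerS addrC.
  by rewrite rpredB // vertex_corner_int // ltnW.
case/intrP => z Ez; have := Hi k; rewrite Ez (ler_int _ 0) (ler_int _ _ 1).
by case: z {Ez} => // -[|[|z]] // _; rewrite !inE eqxx ?orbT.
Qed.

(** Transposing the normal of the exposing halfspace exposes the transpose; this reduces column
    prefix sums to row ones. *)
Lemma vertices_asm_tr (R : realType) (n : nat) (p : 'M[R]_n) :
  vertices (asm_polytope R n) p -> vertices (asm_polytope R n) p^T.
Proof.
have Ptr x : asm_polytope R n x -> asm_polytope R n x^T.
  by move=> /asm_polytopeP[Hr Hc]; apply/asm_polytopeP; rewrite trmxK.
move=> [Pp [_ [[a [b [a0 ->]]] PS]]]; split; first exact: Ptr.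
have Htr x : halfspace a^T b x <-> halfspace a b x^T.
  rewrite /halfspace /= exchange_big.
  by under eq_bigr do under eq_bigr do rewrite mxE -[x]trmxK mxE trmxK.
exists (halfspace a^T b); split.
  exists a^T, b; split=> //; apply: contra_neq a0 => a0.
  by rewrite -[a]trmxK a0 trmx0.
apply/seteqP; split=> [x [Px /Htr Sx]|_ ->] /=.
  have : [set p]%classic x^T by rewrite -PS; split=> //; apply: Ptr.
  by move=> <-; rewrite trmxK.
split; first exact: Ptr.
by apply/Htr; rewrite trmxK; have : [set p]%classic p by []; rewrite -PS => -[].
Qed.

Lemma psum_inj (R : zmodType) (n : nat) (v w : 'I_n -> R) :
  (forall j : 'I_n, psum v j.+1 = psum w j.+1) -> v =1 w.
Proof.
move=> H j; have := H j; rewrite !psumS.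
suff -> : psum v j = psum w j by move/addrI.
case: j => -[|k] /= ltkn; first by rewrite !psum0.
exact: (H (Ordinal (ltnW ltkn))).
Qed.

(* The exposing functional: among polytope points, the sum over all [(i, j)] of
   [r] or [1 - r], where [r] is the row partial sum and the choice makes the
   term vanish at [x], is zero only at [x]. *)
Lemma asm_vertex (R : realType) (n : nat) (x : 'M[R]_n) :
  (0 < n)%N -> asm_polytope R n x ->
  (forall i k, psum (x i) k \in [:: 0; 1]) ->
  vertices (asm_polytope R n) x.
Proof.
move=> n0 Px Hx; split=> //.
(* The sign is 1 where the prefix sum of [x] is 0 and -1 where it is 1, so each signed prefix sum is
   minimal at [x]. *)
pose s (i j : 'I_n) : R := 1 - 2 * psum (x i) j.+1.
(* The entry at [j'] occurs in exactly the prefixes ending at some [j >= j'], which gives its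
   coefficient. *)
pose a : 'M[R]_n := \matrix_(i, j') \sum_(j < n | (j' <= j)%N) s i j.
pose L (y : 'M[R]_n) := \sum_i \sum_j a i j * y i j.
have LE y : L y = \sum_i \sum_j s i j * psum (y i) j.+1.
  apply: eq_bigr => i _.
  under eq_bigr do rewrite mxE big_distrl /=.
  rewrite (exchange_big_dep predT) //=; apply: eq_bigr => j _.
  by rewrite /psum big_distrr.
have term_ge0 y i j : asm_polytope R n y ->
    0 <= s i j * psum (y i) j.+1 - s i j * psum (x i) j.+1.
  move=> /asm_polytopeP[/(_ i)[/(_ j.+1)/andP[ge0 le1] _] _].
  by have := Hx i j.+1; rewrite /s !inE => /orP[] /eqP ->; lra.
exists (halfspace a (L x)); split.
  (* The normal is nonzero: its bottom right entry is the sign of a full row sum,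
     [1 - 2 * 1 = -1]. *)
  exists a, (L x); split=> //; apply/negP => /eqP/matrixP.
  have ltn1 : (n.-1 < n)%N by rewrite prednK.
  move=> /(_ (Ordinal ltn1) (Ordinal ltn1)); rewrite !mxE.
  rewrite (big_pred1 (Ordinal ltn1)) => [|j]; last first.
    rewrite /= eq_sym -val_eqE eqn_leq /= -[X in _ = _ && X]ltnS prednK //.
    by rewrite ltn_ord andbT.
  rewrite /s /= prednK // psum_oversize //.
  by have /asm_polytopeP[/(_ (Ordinal ltn1))[_ ->] _] := Px; lra.
apply/seteqP; split=> [y [Py]|_ ->]; last by split=> //; apply: lexx.
rewrite /halfspace /= -/(L y) -/(L x) => Lyx.
(* The difference is a sum of nonnegative terms, so [L y <= L x] makes every term vanish. *)
have : L y - L x == 0.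
  rewrite eq_le subr_le0 Lyx !LE /= -sumrB sumr_ge0 // => i _.
  by rewrite -sumrB sumr_ge0 // => j _; apply: term_ge0.
rewrite !LE -sumrB psumr_eq0; last first.
  by move=> i _; rewrite -sumrB sumr_ge0 // => j _; apply: term_ge0.
move=> /allP H; apply/matrixP => i; apply: psum_inj => j.
have {H} /= := H i (mem_index_enum _); rewrite -sumrB psumr_eq0; last first.
  by move=> k _; apply: term_ge0.
move=> /allP /(_ j (mem_index_enum _)) /= /eqP.
by have := Hx i j.+1; rewrite /s !inE => /orP[] /eqP ->; lra.
Qed.

Theorem theorem1 (R : realType) (n : nat) (hn : (0 < n)%N) :
  vertices (asm_polytope R n) = standard_asm R n.
Proof.
apply/seteqP; split=> x.
  move=> Vx; apply/standard_asmP; split; first by case: Vx.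
  by split=> i k; apply: vertex_psum => //; apply: vertices_asm_tr.
by move=> /standard_asmP[Px [Hr _]]; apply: asm_vertex.
Qed.
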